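(* Let $X:\mathbb{R}_+\to\mathbb{L}^2(\mathbb{P},\mathbb{H})$ be a continuous and bounded stochastic process and let $\omega>0$. Then the following statements are equivalent: (i) $X\in AP_\omega(\mathbb{R}_+,\mathbb{L}^2(\mathbb{P},\mathbb{H}))$, i.e. $X$ is square mean asymptotically $\omega$-periodic; (ii) $\lim_{n\to\infty}\mathbb{E}\|X(t+n\omega)-Y(t)\|^2=0$ uniformly on $t\in\mathbb{R}_+$, for some stochastic process $Y:\mathbb{R}_+\to\mathbb{L}^2(\mathbb{P},\mathbb{H})$; (iii) $\lim_{n\to\infty}\mathbb{E}\|X(t+n\omega)-Y(t)\|^2=0$ uniformly for $t$ in compact subsets of $\mathbb{R}_+$, for some stochastic process $Y:\mathbb{R}_+\to\mathbb{L}^2(\mathbb{P},\mathbb{H})$; (iv) $\lim_{n\to\infty}\mathbb{E}\|X(t+n\omega)-Y(t)\|^2=0$ uniformly for $t\in[0,\omega]$, for some stochastic process $Y:\mathbb{R}_+\to\mathbb{L}^2(\mathbb{P},\mathbb{H})$, where the convergence is understood as in the following context.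
   Context: $(\mathbb{H},\|\cdot\|)$ is a real separable Hilbert space, $(\Omega,\mathcal{F},\mathbb{P})$ a probability space, and $\mathbb{L}^2(\mathbb{P},\mathbb{H})$ is the Hilbert space of strongly measurable $\mathbb{H}$-valued random variables $X$ with $\mathbb{E}\|X\|^2<\infty$, with norm $\|X\|_2=(\mathbb{E}\|X\|^2)^{1/2}$. A process $X:\mathbb{R}_+\to\mathbb{L}^2(\mathbb{P},\mathbb{H})$ is continuous if $\lim_{t\to s}\mathbb{E}\|X(t)-X(s)\|^2=0$ for every $s$, and bounded if there is $K>0$ with $\mathbb{E}\|X(t)\|^2\le K$ for all $t\ge 0$. A continuous bounded process $X$ is square mean asymptotically $\omega$-periodic if $X=Y+Z$ with $Y,Z$ continuous bounded processes such that $\mathbb{E}\|Y(t+\omega)-Y(t)\|^2=0$ for all $t\ge0$ and $\lim_{t\to\infty}\mathbb{E}\|Z(t)\|^2=0$; the set of these is $AP_\omega(\mathbb{R}_+,\mathbb{L}^2(\mathbb{P},\mathbb{H}))$. In (ii)–(iv), $n$ ranges over $\mathbb{N}$, and uniform convergence on a set $S\subseteq \mathbb{R}_+$ means $\sup_{t\in S}\mathbb{E}\|X(t+n\omega)-Y(t)\|^2\to0$ as $n\to\infty$. *)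

(* Defs.v *)
From HB Require Import structures.
From mathcomp Require Import all_boot all_order all_algebra.
From mathcomp Require Export sesquilinear.
From mathcomp Require Import all_classical all_reals all_analysis.

Set Implicit Arguments.
Unset Strict Implicit.
Unset Printing Implicit Defensive.

Import Order.TTheory GRing.Theory Num.Theory.
Import numFieldNormedType.Exports.

Local Open Scope classical_set_scope.
Local Open Scope ring_scope.

Definition separable_space (T : topologicalType) : Prop :=
  exists2 D : set T, countable D & dense D.

(* The inner product [dot] (symmetric, since its conjugation is [idfun])
   induces the norm of [H]; completeness is part of [completeNormedModType]. *)
Definition hilbert_norm (R : realType) (H : completeNormedModType R)
    (dot : {dot H for idfun}) : Prop :=
  forall x : H, `|x| ^+ 2 = dot x x.

Definition nneg (R : realType) : set R := [set t | 0 <= t].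

Section SquareMean.
Context {d : measure_display} {T : measurableType d} {R : realType}
  {H : completeNormedModType R}.
Variable P : probability T R.

Implicit Types (U : T -> H) (X Y Z : R -> T -> H).

Definition simple_rv U : Prop :=
  finite_set (range U) /\ forall y : H, measurable (U @^-1` [set y]).

Definition strongly_measurable U : Prop :=
  exists s : nat -> T -> H, (forall n, simple_rv (s n)) /\
    forall w, s n w @[n --> \oo] --> U w.

(* E||U||^2, as an extended real *)
Definition msq U : \bar R := 'E_P[fun w => `|U w| ^+ 2].

Definition L2rv U : Prop := strongly_measurable U /\ (msq U < +oo)%E.

(* A process indexed by R_+ is encoded as a function on R of which only the
   values at t >= 0 matter. Elements of L^2 are represented by functions, so
   equality in L^2 is almost sure equality. *)
Definition process X : Prop := forall t, 0 <= t -> L2rv (X t).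

Definition msq_continuous X : Prop := forall s, 0 <= s ->
  msq (X t \- X s) @[t --> within (@nneg R) (nbhs s)] --> 0%E.

Definition msq_bounded X : Prop := exists2 K : R, 0 < K &
  forall t, 0 <= t -> (msq (X t) <= K%:E)%E.

Definition cb_process X : Prop :=
  [/\ process X, msq_continuous X & msq_bounded X].

Definition asymptotically_periodic (omega : R) X : Prop :=
  cb_process X /\
  exists Y Z,
    [/\ cb_process Y, cb_process Z,
        forall t, 0 <= t -> {ae P, forall w, X t w = Y t w + Z t w},
        forall t, 0 <= t -> msq (Y (t + omega) \- Y t) = 0%E &
        msq (Z t) @[t --> +oo] --> 0%E].

(* The supremum is taken in [0, +oo], so that it is 0 over the empty set. *)
Definition shift_cvg_unif (omega : R) X Y (S : set R) : Prop :=
  ereal_sup (0%E |` [set msq (X (t + n%:R * omega) \- Y t) | t in S])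
    @[n --> \oo] --> 0%E.

End SquareMean.

(* Main.v *)
Require Import Defs.
From HB Require Import structures.
From mathcomp Require Import all_boot all_order all_algebra.
From mathcomp Require Import all_classical all_reals all_analysis.
From mathcomp Require Import measurable_realfun.
From mathcomp Require Import lra.

(* Everything rests on E|U - W|^2 <= 2 (E|U - V|^2 + E|V - W|^2).
   If X = Y + Z is asymptotically periodic, then X (t + n omega) - Y t is
   Z (t + n omega) up to an L^2-null term, which vanishes uniformly in t >= 0.
   Conversely, if X (t + n omega) tends to Y t uniformly on [0, omega], let Y'
   be the periodic extension of Y restricted to [0, omega[.  Writing
   t = r + k omega with r in [0, omega[, X (t + n omega) = X (r + (k + n) omega),
   so the convergence to Y' is uniform on all of R_+.  Hence Y' inherits
   continuity and boundedness from X (there is no need to compare Y 0 with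
   Y omega), and the uniform convergence says that X - Y' vanishes at infinity. *)

Import Order.TTheory GRing.Theory Num.Theory.
Import numFieldNormedType.Exports.

Local Open Scope classical_set_scope.
Local Open Scope ring_scope.

(** * Strong measurability of differences and of squared norms *)

Section StronglyMeasurable.
Context {d : measure_display} {T : measurableType d} {R : realType}
  {H : completeNormedModType R}.
Implicit Types U V W : T -> H.

(** The preimage of [A] is the finite union of the fibres over the values of [U] lying in [A]. This
    gives measurability of the norm of a simple variable with no sigma-algebra on [H]. *)
Lemma simple_rv_comp_preimage U (A : set H) :
  simple_rv U -> measurable (U @^-1` A).
Proof.
move=> [finU mU].
rewrite [X in measurable X](_ : _ =
    \bigcup_(y in range U `&` A) (U @^-1` [set y])).
  by apply: fin_bigcup_measurable => //; exact: finite_setIl.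
apply/seteqP; split=> [w Aw|w [y [_ Ay]] /= ->//].
by exists (U w) => //; split=> //; exists w.
Qed.

Lemma simple_rvB U V : simple_rv U -> simple_rv V -> simple_rv (U \- V).
Proof.
move=> sU sV; split.
  apply: (@sub_finite_set _ _ [set p.1 - p.2 | p in range U `*` range V]).
    by move=> _ [w _ <-]; exists (U w, V w).
  by apply/finite_image/finite_setX; [case: sU|case: sV].
move=> y.
(* Split the event [U - V = y] according to the value [b] of [V], which forces [U = y + b]. *)
rewrite [X in measurable X](_ : _ = \bigcup_(b in range V)
    (U @^-1` [set y + b] `&` V @^-1` [set b])).
  apply: fin_bigcup_measurable; first by case: sV.
  by move=> b _; apply: measurableI; [case: sU|case: sV].
apply/seteqP; split=> [w /= <-|w [b _ [/= -> ->]]].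
  by exists (V w); [exists w|split=> //=; rewrite subrK].
by rewrite addrK.
Qed.

Lemma strongly_measurableB U V :
  strongly_measurable U -> strongly_measurable V ->
  strongly_measurable (U \- V).
Proof.
move=> [u [su uU]] [v [sv vV]]; exists (fun n => u n \- v n).
by split=> [n|w]; [exact: simple_rvB|apply: cvgB].
Qed.

Lemma strongly_measurable_sqrnorm U : strongly_measurable U ->
  measurable_fun setT (fun w => `|U w| ^+ 2).
Proof.
move=> [u [su uU]]; apply: measurable_funX.
apply: (@measurable_fun_cvg _ _ _ _ (fun n w => `|u n w|)).
  move=> n _ A mA; rewrite setTI.
  exact: (@simple_rv_comp_preimage (u n) ((fun x => `|x|) @^-1` A)).
by move=> w _; apply: cvg_norm.
Qed.

End StronglyMeasurable.

(** * Mean-square estimates *)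

Section Msq.
Context {d : measure_display} {T : measurableType d} {R : realType}
  {H : completeNormedModType R}.
Variable P : probability T R.
Implicit Types U V W : T -> H.

Lemma msq_ge0 U : (0 <= msq P U)%E.
Proof.
by rewrite /msq unlock; apply: integral_ge0 => w _; rewrite lee_fin exprn_ge0.
Qed.

Lemma eq_msq0 U : (forall w, U w = 0) -> msq P U = 0%E.
Proof.
move=> U0; rewrite /msq unlock.
by under eq_integral do rewrite U0 normr0 expr0n; rewrite integral0.
Qed.

Lemma ae_eq_msq U V : strongly_measurable U -> strongly_measurable V ->
  {ae P, forall w, U w = V w} -> msq P U = msq P V.
Proof.
move=> mU mV UV; rewrite /msq unlock; apply: ge0_ae_eq_integral => //.
- by apply/measurable_EFinP; exact: strongly_measurable_sqrnorm.
- by apply/measurable_EFinP; exact: strongly_measurable_sqrnorm.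
- move: UV => [N [mN N0 UVN]]; exists N; split=> // w /= UVw.
  by apply: UVN => /= eqUV; apply: UVw => _; rewrite eqUV.
Qed.

(** Common source of the quasi-triangle inequalities below: a pointwise triangle inequality is
    squared with [(y + z)^2 <= 2 (y^2 + z^2)], then integrated. *)
Lemma msq_le_norm W U V (a b : R) :
  strongly_measurable U -> strongly_measurable V -> strongly_measurable W ->
  (forall w, `|W w| <= `|U w| + `|V w|) ->
  (msq P U <= a%:E)%E -> (msq P V <= b%:E)%E ->
  (msq P W <= (2 * (a + b))%:E)%E.
Proof.
move=> mU mV mW WUV Ua Vb.
have mE Z : strongly_measurable Z ->
    measurable_fun setT (fun w => (`|Z w : H| ^+ 2)%:E).
  by move=> mZ; apply/measurable_EFinP; exact: strongly_measurable_sqrnorm.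
have E0 Z w : (0 <= (`|Z w : H| ^+ 2)%:E :> \bar R)%E.
  by rewrite lee_fin exprn_ge0.
apply: (@le_trans _ _ (2%:E * (msq P U + msq P V))%E); last first.
  by rewrite EFinM lee_pmul2l// EFinD leeD.
rewrite /msq unlock -ge0_integralD//; [|exact: mE|exact: mE].
rewrite -ge0_integralZl//; last 2 first.
- by apply: emeasurable_funD; exact: mE.
- by move=> w _; rewrite adde_ge0.
apply: ge0_le_integral => //; first exact: mE.
  by apply: emeasurable_funM => //; apply: emeasurable_funD; exact: mE.
move=> w _; rewrite -EFinD -EFinM lee_fin.
have := WUV w; have := normr_ge0 (W w).
move: `|W w| `|U w| `|V w| => x y z x0 xyz.
have : x ^+ 2 <= (y + z) ^+ 2 by rewrite lerXn2r// nnegrE (le_trans x0).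
(* [(y - z)^2 >= 0] is what bounds the cross term [2yz] by [y^2 + z^2]. *)
by have := sqr_ge0 (y - z); rewrite !expr2; nra.
Qed.

Lemma msqB_le U V (a b : R) : L2rv P U -> L2rv P V ->
  (msq P U <= a%:E)%E -> (msq P V <= b%:E)%E ->
  (msq P (U \- V)%R <= (2 * (a + b))%:E)%E.
Proof.
move=> [mU _] [mV _]; apply: msq_le_norm => // [|w].
  exact: strongly_measurableB.
exact: ler_normB.
Qed.

Lemma msq_subl_le U V (a b : R) : L2rv P U -> L2rv P V ->
  (msq P (U \- V)%R <= a%:E)%E -> (msq P U <= b%:E)%E ->
  (msq P V <= (2 * (a + b))%:E)%E.
Proof.
move=> [mU _] [mV _]; apply: msq_le_norm => // [|w].
  exact: strongly_measurableB.
by rewrite distrC -[V w in leLHS](subrK (U w)) ler_normD.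
Qed.

Lemma msqBC U V : msq P (U \- V)%R = msq P (V \- U)%R.
Proof. by congr expectation; apply/funext => w /=; rewrite distrC. Qed.

Lemma msq_dist_le V U W (a b : R) : L2rv P U -> L2rv P V -> L2rv P W ->
  (msq P (U \- V)%R <= a%:E)%E -> (msq P (V \- W)%R <= b%:E)%E ->
  (msq P (U \- W)%R <= (2 * (a + b))%:E)%E.
Proof.
move=> [mU _] [mV _] [mW _]; apply: msq_le_norm; try exact: strongly_measurableB.
by move=> w; exact: ler_distD.
Qed.

Lemma L2rvB U V : L2rv P U -> L2rv P V -> L2rv P (U \- V).
Proof.
move=> LU LV; split; first by apply: strongly_measurableB; [case: LU|case: LV].
have [[_ fU] [_ fV]] := (LU, LV).
apply: (@le_lt_trans _ _ (2 * (fine (msq P U) + fine (msq P V)))%:E).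
  by apply: msqB_le => //; rewrite fineK// ge0_fin_numE// msq_ge0.
exact: ltry.
Qed.

End Msq.

(** * Epsilon forms of the convergences *)

Section Limits.
Context {R : realType}.
Local Open Scope ereal_scope.

Lemma cvge0P {I : Type} (F : set_system I) (FF : Filter F) (f : I -> \bar R) :
  (forall i, 0 <= f i) ->
  f @ F --> 0 <-> forall e : R, (0 < e)%R -> \forall i \near F, f i <= e%:E.
Proof.
move=> f0; split=> [fF e e0|fF].
  have he : \forall i \near F, f i < e%:E.
    suff /fF : nbhs (0 : \bar R) [set x | x < e%:E] by [].
    by apply: open_ereal_lt'; rewrite lte_fin.
  by apply: filterS he => i /ltW.
apply/fine_cvgP; split.
  (* Being eventually at most 1 makes the values finite, so convergence can be tested on real
     parts. *)
  apply: filterS (fF 1%R ltr01) => i fi.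
  by rewrite ge0_fin_numE//; apply: le_lt_trans (ltry 1).
apply/cvgrPdist_le => e e0; apply: filterS (fF e e0) => i fi /=.
rewrite sub0r normrN ger0_norm ?fine_ge0//.
by rewrite -lee_fin fineK// ge0_fin_numE//; apply: le_lt_trans (ltry e).
Qed.

Context {d : measure_display} {T : measurableType d}
  {H : completeNormedModType R}.
Variable P : probability T R.
Implicit Types X Y Z : R -> T -> H.

Lemma shift_cvg_unifP omega X Y (S : set R) :
  shift_cvg_unif P omega X Y S <->
  forall e : R, (0 < e)%R -> exists N, forall n t, (N <= n)%N -> S t ->
    msq P (X (t + n%:R * omega) \- Y t)%R <= e%:E.
Proof.
rewrite /shift_cvg_unif cvge0P; last first.
  (* The adjoined 0 keeps the supremum nonnegative, even for empty [S]. *)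
  by move=> n; apply: ereal_sup_ubound; left.
split=> cXY e e0; have := cXY e e0.
  move=> [N _ hN]; exists N => n t Nn St.
  by apply: le_trans (hN n Nn); apply: ereal_sup_ubound; right; exists t.
move=> [N hN]; near=> n; apply: ge_ereal_sup => _ [->|[t St <-]].
  by rewrite lee_fin ltW.
by apply: hN => //; near: n; exact: nbhs_infty_ge.
Unshelve. all: by end_near. Qed.

Lemma msq_continuousP X : msq_continuous P X <->
  forall s (e : R), (0 <= s)%R -> (0 < e)%R -> exists2 r : R, (0 < r)%R &
    forall t, (0 <= t)%R -> (`|s - t| < r)%R -> msq P (X t \- X s)%R <= e%:E.
Proof.
split=> [cX s e s0 e0|cX s s0].
  have /cvge0P := cX s s0; move=> /(_ (fun=> msq_ge0 _ _) e e0).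
  rewrite near_withinE => /nbhs_ballP[r /= r0 hr].
  by exists r => // t t0 st; exact: hr.
apply/cvge0P => [t|e e0]; first exact: msq_ge0.
rewrite near_withinE; apply/nbhs_ballP; have [r r0 hr] := cX s e s0 e0.
by exists r => // t st t0; exact: hr.
Qed.

Lemma msq_cvgyP Z : msq P (Z t) @[t --> +oo%R] --> 0 <->
  forall e : R, (0 < e)%R -> exists M : R,
    forall t, (M <= t)%R -> msq P (Z t) <= e%:E.
Proof.
rewrite cvge0P; last by move=> t; exact: msq_ge0.
split=> cZ e e0; have := cZ e e0.
  move=> [M [_ hM]]; exists (M + 1)%R => t Mt.
  by apply: hM; lra.
by move=> [M hM]; exists M; split=> [|t /ltW]; [exact: num_real|exact: hM].
Qed.

Lemma shift_cvg_unifS omega X Y (S S' : set R) : S `<=` S' ->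
  shift_cvg_unif P omega X Y S' -> shift_cvg_unif P omega X Y S.
Proof.
move=> SS' /shift_cvg_unifP cXY; apply/shift_cvg_unifP => e /cXY[N hN].
by exists N => n t Nn St; apply: hN => //; exact: SS'.
Qed.

Lemma cb_processB X Y : cb_process P X -> cb_process P Y ->
  cb_process P (fun t => X t \- Y t)%R.
Proof.
move=> [pX cX [K K0 bX]] [pY cY [L L0 bY]]; split.
- by move=> t t0; apply: L2rvB; [exact: pX|exact: pY].
- apply/msq_continuousP => s e s0 e0.
  have e4 : (0 < e / 4)%R by lra.
  move/msq_continuousP : cX => /(_ s _ s0 e4)[r r0 hr].
  move/msq_continuousP : cY => /(_ s _ s0 e4)[q q0 hq].
  exists (Num.min r q) => [|t t0]; first by rewrite lt_min r0.
  rewrite lt_min => /andP[str stq].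
  have -> : e = (2 * (e / 4 + e / 4))%R by lra.
  rewrite [X in msq P X](_ : _ = ((X t \- X s) \- (Y t \- Y s))%R).
    by apply: msqB_le; rewrite ?hr ?hq//; apply: L2rvB;
      [exact: pX|exact: pX|exact: pY|exact: pY].
  apply/funext => w /=; rewrite !opprB addrACA [RHS]addrACA; congr (_ + _)%R.
  exact: addrC.
- exists (2 * (K + L))%R; first by lra.
  by move=> t t0; apply: msqB_le; [exact: pX|exact: pY|exact: bX|exact: bY].
Qed.

(** * Asymptotic periodicity versus convergence of the shifts *)

Lemma shift_ge0 (omega : R) : (0 <= omega)%R ->
  forall (t : R) n, (0 <= t)%R -> (0 <= t + n%:R * omega)%R.
Proof. by move=> omega0 t n t0; rewrite addr_ge0// mulr_ge0. Qed.

(** Uniform-limit argument: a single shift of [X] is close to [Y] at all nonnegative times at once,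
    and passes its continuity and bound on to [Y]. *)
Lemma shift_limit_cb_process omega X Y : (0 < omega)%R ->
  cb_process P X -> process P Y ->
  shift_cvg_unif P omega X Y (@nneg R) -> cb_process P Y.
Proof.
move=> omega0 [pX cX [K K0 bX]] pY /shift_cvg_unifP cXY.
have shift_ge0 := shift_ge0 omega (ltW omega0).
split=> //.
- apply/msq_continuousP => s e s0 e0.
  (* The path [Y t], [X (t + N omega)], [X (s + N omega)], [Y s] uses the quasi-triangle inequality
     twice; its nested factors 2 turn three bounds [e / 10] into [e]. *)
  have e10 : (0 < e / 10)%R by lra.
  have [N /(_ N _ (leqnn N)) hN] := cXY _ e10.
  move/msq_continuousP : cX => /(_ _ _ (shift_ge0 s N s0) e10)[r r0 hr].
  exists r => // t t0 str.
  have -> : e = (2 * (2 * (e / 10 + e / 10) + e / 10))%R by lra.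
  apply: (@msq_dist_le _ _ _ _ _ (X (s + N%:R * omega)%R)).
  + exact: pY.
  + by apply/pX/shift_ge0.
  + exact: pY.
  + apply: (@msq_dist_le _ _ _ _ _ (X (t + N%:R * omega)%R)).
    * exact: pY.
    * by apply/pX/shift_ge0.
    * by apply/pX/shift_ge0.
    * by rewrite msqBC; exact: hN.
    * apply: hr; first exact: shift_ge0.
      by rewrite opprD addrACA subrr addr0.
  + exact: hN.
- have [N /(_ N _ (leqnn N)) hN] := cXY _ ltr01.
  exists (2 * (1 + K))%R; first by lra.
  move=> t t0; apply: (@msq_subl_le _ _ _ _ _ (X (t + N%:R * omega)%R)).
  + by apply/pX/shift_ge0.
  + exact: pY.
  + exact: hN.
  + by apply/bX/shift_ge0.
Qed.

Lemma asymptotically_periodic_shift_cvg omega X : (0 < omega)%R ->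
  asymptotically_periodic P omega X ->
  exists Y, process P Y /\ shift_cvg_unif P omega X Y (@nneg R).
Proof.
move=> omega0 [[pX _ _] [Y [Z [[pY _ _] [pZ _ _] XYZ perY /msq_cvgyP cZ]]]].
have shift_ge0 := shift_ge0 omega (ltW omega0).
have perYn n t : (0 <= t)%R -> msq P (Y (t + n%:R * omega) \- Y t)%R <= 0%:E.
  move=> t0; elim: n => [|n IH].
    by rewrite mul0r addr0 eq_msq0// => w /=; rewrite subrr.
  (* The bound is exactly 0, so the factor 2 does not accumulate along the induction. *)
  rewrite [X in X%:E](_ : _ = (2 * (0 + 0))%R); last by lra.
  apply: (@msq_dist_le _ _ _ _ _ (Y (t + n%:R * omega)%R)) => //.
  - by apply/pY/shift_ge0.
  - by apply/pY/shift_ge0.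
  - exact: pY.
  - by rewrite -natr1 mulrDl mul1r addrA perY//; exact: shift_ge0.
exists Y; split=> //; apply/shift_cvg_unifP => e e0.
have /cZ[M hM] : (0 < e / 2)%R by lra.
(* Once [n omega >= M], every [t + n omega] with [t >= 0] lies beyond [M]; hence the uniformity in
   [t]. *)
have [N _ hN] : \forall n \near \oo, (M / omega <= n%:R)%R.
  exact: nbhs_infty_ger.
exists N => n t Nn t0.
have -> : e = (2 * (e / 2 + 0))%R by lra.
apply: (@msq_dist_le _ _ _ _ _ (Y (t + n%:R * omega)%R)).
- by apply/pX/shift_ge0.
- by apply/pY/shift_ge0.
- exact: pY.
(* [X - Y] agrees with [Z] only almost surely, which the mean square does not see. *)
- rewrite (@ae_eq_msq _ _ _ _ _ _ (Z (t + n%:R * omega)%R)).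
  + apply: hM; rewrite -[leLHS]add0r lerD// -ler_pdivrMr//; exact: hN.
  + by apply: strongly_measurableB; [apply: (pX _ _).1|apply: (pY _ _).1];
      exact: shift_ge0.
  + by apply: (pZ _ _).1; exact: shift_ge0.
  + by apply: filterS (XYZ _ (shift_ge0 t n t0)) => w /= ->; rewrite addrC addKr.
- exact: perYn.
Qed.

(** The remainder of [t] modulo [omega] for [t >= 0]; composing [Y] with it yields the periodic
    extension. *)
Definition periodic_rem (omega t : R) : R :=
  (t - (Num.truncn (t / omega))%:R * omega)%R.

Lemma periodic_rem_itv omega t : (0 < omega)%R -> (0 <= t)%R ->
  (0 <= periodic_rem omega t <= omega)%R.
Proof.
move=> omega0 t0; have : (0 <= t / omega)%R by rewrite divr_ge0// ltW.
move=> /truncn_itv; rewrite /periodic_rem.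
rewrite ler_pdivlMr// ltr_pdivrMr// -natr1 mulrDl mul1r => /andP[h1 h2].
by lra.
Qed.

Lemma periodic_remD omega t n : (0 < omega)%R -> (0 <= t)%R ->
  periodic_rem omega (t + n%:R * omega) = periodic_rem omega t.
Proof.
move=> omega0 t0; rewrite /periodic_rem mulrDl mulfK ?gt_eqF//.
rewrite [(t / omega + _)%R]addrC truncnD ?natr_nat ?natrK ?nnegrE ?divr_ge0 ?(ltW omega0)//.
by rewrite natrD mulrDl opprD addrA addrK.
Qed.

Lemma shift_cvg_unif_periodic omega X Y : (0 < omega)%R ->
  shift_cvg_unif P omega X Y `[0%R, omega] ->
  shift_cvg_unif P omega X (Y \o periodic_rem omega) (@nneg R).
Proof.
move=> omega0 /shift_cvg_unifP cXY; apply/shift_cvg_unifP => e /cXY[N hN].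
exists N => n t Nn t0 /=.
have -> : (t + n%:R * omega = periodic_rem omega t +
    (Num.truncn (t / omega) + n)%:R * omega)%R.
  by rewrite /periodic_rem natrD mulrDl addrA subrK.
(* The whole periods contained in [t] only increase the number of shifts, so the rank [N] found on
   [[0, omega]] serves every [t]. *)
apply: hN; first by rewrite (leq_trans Nn)// leq_addl.
by rewrite /= in_itv/= periodic_rem_itv.
Qed.

Lemma shift_cvg_asymptotically_periodic omega X Y : (0 < omega)%R ->
  cb_process P X -> process P Y ->
  shift_cvg_unif P omega X Y `[0%R, omega] -> asymptotically_periodic P omega X.
Proof.
move=> omega0 cbX pY /(shift_cvg_unif_periodic _ _ _ omega0) cXY; split=> //.
set Y' := Y \o _ in cXY.
have pY' : process P Y'.
  by move=> t t0; apply: pY; case/andP: (periodic_rem_itv _ _ omega0 t0).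
have cbY' := shift_limit_cb_process _ _ _ omega0 cbX pY' cXY.
exists Y', (fun t => X t \- Y' t)%R; split=> //.
- exact: cb_processB.
- by move=> t _; apply: nearW => w /=; rewrite addrC subrK.
- move=> t t0; apply: eq_msq0 => w /=.
  by have := periodic_remD _ _ 1 omega0 t0; rewrite mul1r /Y' /= => ->; rewrite subrr.
- apply/msq_cvgyP => e /((shift_cvg_unifP _ _ _ _).1 cXY)[N hN].
  (* For [t >= N omega], put [t' = t - N omega]. Periodicity gives [Y' t = Y' t'], so [X t - Y' t]
     is the [N]-th shift error at [t']. *)
  exists (N%:R * omega)%R => t tN.
  have t0 : (0 <= t - N%:R * omega)%R by rewrite subr_ge0.
  have := hN _ _ (leqnn N) t0.
  by rewrite -[Y' _]/(Y _) -(periodic_remD _ _ N omega0 t0) subrK.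
Qed.

End Limits.

Theorem theorem2p4 (R : realType)
    (H : completeNormedModType R) (dot : {dot H for idfun})
    (hdot : hilbert_norm dot) (hsep : separable_space H)
    (d : measure_display) (T : measurableType d) (P : probability T R)
    (X : R -> T -> H) (hX : cb_process P X)
    (omega : R) (homega : 0 < omega) :
  [<-> asymptotically_periodic P omega X;
       exists Y : R -> T -> H, process P Y /\
         shift_cvg_unif P omega X Y (@nneg R);
       exists Y : R -> T -> H, process P Y /\
         forall K : set R, compact K -> K `<=` @nneg R ->
           shift_cvg_unif P omega X Y K;
       exists Y : R -> T -> H, process P Y /\
         shift_cvg_unif P omega X Y `[0, omega]].
Proof.
tfae.
- exact: asymptotically_periodic_shift_cvg.
- move=> [Y [pY cXY]]; exists Y; split=> // K _ K0.
  exact: shift_cvg_unifS cXY.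
- move=> [Y [pY cXY]]; exists Y; split=> //; apply: cXY.
    exact: segment_compact.
  by move=> t /=; rewrite in_itv/= => /andP[].
- by move=> [Y [pY cXY]]; exact: shift_cvg_asymptotically_periodic cXY.
Qed.
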